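(* Let $U=M_\xi$ be multiplication by the independent variable on the direct integral $\mathcal H\subset L^2(\mu;E)$, let $\mathbf B:\mathbb C^d\to\mathcal H$ be an isometry, let $\Gamma$ be a strict contraction on $\mathbb C^d$, and let $T_\Gamma=U+\mathbf B(\Gamma-\mathbf I)\mathbf B^*U$. Then the characteristic function $\theta_{T_\Gamma}$ of $T_\Gamma$ with coordinate operators $V=\mathbf B^*U$, $V_*=\mathbf B^*$ (and $\mathfrak D=\mathfrak D_*=\mathbb C^d$) is given, for $z\in\mathbb D$, by $$\theta_{T_\Gamma}(z)=-\Gamma+D_{\Gamma^*}F_1(z)\bigl(\mathbf I-(\Gamma^*-\mathbf I)F_1(z)\bigr)^{-1}D_\Gamma=-\Gamma+D_{\Gamma^*}\bigl(\mathbf I-F_1(z)(\Gamma^*-\mathbf I)\bigr)^{-1}F_1(z)D_\Gamma,$$ where $$F_1(z)=\int_{\mathbb T}\frac{z\bar\xi}{1-z\bar\xi}\,B(\xi)^*B(\xi)\,d\mu(\xi),\qquad z\in\mathbb D.$$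
   Context: Direct integral: $\mu$ is a finite positive Borel measure on the unit circle $\mathbb T$; $E$ is a separable Hilbert space with orthonormal basis $(\varepsilon_n)_{n\ge1}$; $N:\mathbb T\to\mathbb N\cup\{\infty\}$ is measurable; $E(\xi)=\overline{\operatorname{span}}\{\varepsilon_n:1\le n\le N(\xi)\}$; $\mathcal H=\{f\in L^2(\mu;E): f(\xi)\in E(\xi)\ \mu\text{-a.e.}\}$. $e_1,\dots,e_d$ is the standard basis of $\mathbb C^d$, $b_k=\mathbf Be_k\in\mathcal H$, and $B(\xi)=(b_1(\xi),\dots,b_d(\xi)):\mathbb C^d\to E(\xi)$, so that $B(\xi)^*B(\xi)$ is the $d\times d$ matrix with entries $b_j(\xi)^*b_k(\xi)=(b_k(\xi),b_j(\xi))_E$. Strict contraction: $\|\Gamma x\|<\|x\|$ for all $x\ne0$. For a contraction $A$: $D_A=(\mathbf I-A^*A)^{1/2}$, $D_{A^*}=(\mathbf I-AA^* )^{1/2}$, $\mathfrak D_A=\operatorname{clos}\operatorname{Ran}D_A$. For $T=T_\Gamma$ one has $\mathfrak D_T=U^*\operatorname{Ran}\mathbf B$ and $\mathfrak D_{T^*}=\operatorname{Ran}\mathbf B$, and $V=\mathbf B^*U:\mathfrak D_T\to\mathbb C^d$, $V_*=\mathbf B^*:\mathfrak D_{T^*}\to\mathbb C^d$ are unitary. The characteristic function of a contraction $T$ with coordinate operators $V:\mathfrak D_T\to\mathfrak D$, $V_*:\mathfrak D_{T^*}\to\mathfrak D_*$ (unitary) is $\theta_T(z)=V_*\bigl(-T+zD_{T^*}(\mathbf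 I-zT^* )^{-1}D_T\bigr)V^*|_{\mathfrak D}$, $z\in\mathbb D$. *)

(* Defs.v *)
From HB Require Import structures.
From mathcomp Require Import all_boot all_order all_algebra.
From mathcomp Require Import all_classical all_reals all_analysis.
From mathcomp Require Import measurable_realfun complex ring_quotient.
From mathcomp Require Import ring lra.
Set Implicit Arguments. Unset Strict Implicit. Unset Printing Implicit Defensive.
Import Order.TTheory GRing.Theory Num.Theory.
Import numFieldNormedType.Exports.
Local Open Scope classical_set_scope.
Local Open Scope ring_scope.
Local Open Scope complex_scope.

(* [inner] is linear in its first argument and conjugate-linear in its second *)
HB.mixin Record Lmodule_hasInner (R : realType) E of GRing.Lmodule R[i] E :=
  { inner : {dot E for Num.conj_op} }.

#[short(type=innerType)]
HB.structure Definition InnerSpace (R : realType) :=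
  { E of GRing.Lmodule R[i] E & Lmodule_hasInner R E }.

Section InnerTheory.
Variables (R : realType) (E : innerType R).
Implicit Types (x y z : E) (a : R[i]).

Definition sqn x : R := complex.Re (inner x x).
Definition inorm x : R := Num.sqrt (sqn x).

Lemma innerDl x y z : inner (x + y) z = inner x z + inner y z.
Proof. by rewrite linearDl. Qed.
Lemma innerDr x y z : inner z (x + y) = inner z x + inner z y.
Proof. by rewrite linearD. Qed.
Lemma innerZl a x y : inner (a *: x) y = a * inner x y.
Proof. by rewrite linearZl_LR. Qed.
Lemma innerZr a x y : inner x (a *: y) = Num.conj a * inner x y.
Proof. by rewrite linearZr_LR. Qed.
Lemma inner0l x : inner 0 x = 0. Proof. by rewrite linear0l. Qed.
Lemma inner0r x : inner x 0 = 0. Proof. by rewrite linear0r. Qed.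
Lemma innerNl x y : inner (- x) y = - inner x y. Proof. by rewrite linearNl. Qed.
Lemma innerNr x y : inner x (- y) = - inner x y. Proof. by rewrite linearN. Qed.
Lemma innerC x y : inner x y = Num.conj (inner y x).
Proof. by rewrite hermC expr0 mul1r. Qed.
Lemma inner_suml (I : Type) (s : seq I) (F : I -> E) x :
  inner (\sum_(i <- s) F i) x = \sum_(i <- s) inner (F i) x.
Proof.
by elim: s => [|i s IH]; rewrite ?big_nil ?inner0l // !big_cons innerDl IH.
Qed.
Lemma inner_sumr (I : Type) (s : seq I) (F : I -> E) x :
  inner x (\sum_(i <- s) F i) = \sum_(i <- s) inner x (F i).
Proof.
by elim: s => [|i s IH]; rewrite ?big_nil ?inner0r // !big_cons innerDr IH.
Qed.

Lemma ReD (a b : R[i]) : complex.Re (a + b) = complex.Re a + complex.Re b.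
Proof. by case: a b => [? ?] [? ?]. Qed.
Lemma ReN (a : R[i]) : complex.Re (- a) = - complex.Re a.
Proof. by case: a. Qed.
Lemma ImD (a b : R[i]) : complex.Im (a + b) = complex.Im a + complex.Im b.
Proof. by case: a b => [? ?] [? ?]. Qed.
Lemma Re_conj (a : R[i]) : complex.Re (Num.conj a) = complex.Re a.
Proof. by case: a. Qed.
Lemma Im_conj (a : R[i]) : complex.Im (Num.conj a) = - complex.Im a.
Proof. by case: a. Qed.
Lemma ReM (a b : R[i]) : complex.Re (a * b) =
  complex.Re a * complex.Re b - complex.Im a * complex.Im b.
Proof. by case: a b => [? ?] [? ?]. Qed.
Lemma ImM (a b : R[i]) : complex.Im (a * b) =
  complex.Re a * complex.Im b + complex.Im a * complex.Re b.
Proof. by case: a b => [? ?] [? ?]. Qed.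

Lemma innerxx x : inner x x = (sqn x)%:C.
Proof.
have /ger0_Im h : 0 <= inner x x by exact: dnorm_ge0.
by rewrite /sqn [LHS]complexE h mulr0 addr0.
Qed.

Lemma sqn_ge0 x : 0 <= sqn x.
Proof. by rewrite -ler0c -innerxx dnorm_ge0. Qed.

Lemma sqn_eq0 x : sqn x = 0 -> x = 0.
Proof. by move=> x0; apply/eqP; rewrite -(dnorm_eq0 inner) innerxx x0. Qed.

Lemma sqnD x y : sqn (x + y) = sqn x + sqn y + 2 * complex.Re (inner x y).
Proof.
rewrite /sqn innerDl !innerDr !ReD (innerC y x) Re_conj; ring.
Qed.

Lemma sqnN x : sqn (- x) = sqn x.
Proof. by rewrite /sqn innerNl innerNr opprK. Qed.

Lemma sqnZ a x :
  sqn (a *: x) = (complex.Re a ^+ 2 + complex.Im a ^+ 2) * sqn x.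
Proof.
rewrite /sqn innerZl innerZr innerxx !ReM !ImM Re_conj Im_conj /=; ring.
Qed.

Lemma sqnD_le x y : sqn (x + y) <= 2 * sqn x + 2 * sqn y.
Proof. by have := sqn_ge0 (x - y); rewrite !sqnD sqnN innerNr ReN; lra. Qed.

Lemma inorm_sqr x : inorm x ^+ 2 = sqn x.
Proof. by rewrite sqr_sqrtr// sqn_ge0. Qed.

Lemma inorm_ge0 x : 0 <= inorm x. Proof. exact: sqrtr_ge0. Qed.

Lemma inorm_lt x (e : R) : 0 < e -> (inorm x < e) = (sqn x < e ^+ 2).
Proof.
move=> e0; rewrite -inorm_sqr ltr_pXn2r// nnegrE ?inorm_ge0//.
exact: ltW.
Qed.

Definition iclosure (A : set E) : set E :=
  [set x | forall e : R, 0 < e -> exists2 y, A y & inorm (x - y) < e].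

Definition lspan (A : set E) : set E :=
  [set x | exists2 s : seq (R[i] * E), (forall p, p \in s -> A p.2) &
           x = \sum_(p <- s) p.1 *: p.2].

Definition clspan (A : set E) : set E := iclosure (lspan A).

Definition icvg (u : nat -> E) (l : E) : Prop :=
  inorm (u n - l) @[n --> \oo] --> (0 : R).

Definition icauchy (u : nat -> E) : Prop :=
  forall e : R, 0 < e -> exists n0 : nat, forall m n : nat,
    (n0 <= m)%N -> (n0 <= n)%N -> inorm (u m - u n) < e.

Lemma span0 A : lspan A 0.
Proof. by exists [::] => //; rewrite big_nil. Qed.

Lemma span_lin A a x y : lspan A x -> lspan A y -> lspan A (a *: x + y).
Proof.
move=> [s hs ->] [t ht ->].
exists ([seq (a * p.1, p.2) | p <- s] ++ t) => [p|].
  rewrite mem_cat => /orP[/mapP[q qs ->]|]; [exact: (hs q)|exact: ht].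
rewrite big_cat big_map scaler_sumr; congr (_ + _).
by apply: eq_bigr => p _; rewrite scalerA.
Qed.

Lemma clspan0 A : clspan A 0.
Proof.
move=> e e0; exists 0; first exact: span0.
by rewrite subrr /inorm /sqn inner0l sqrtr0.
Qed.

Lemma clspan_lin A a x y : clspan A x -> clspan A y -> clspan A (a *: x + y).
Proof.
move=> hx hy e e0.
pose K : R := complex.Re a ^+ 2 + complex.Im a ^+ 2 + 1.
have K1 : 1 <= K by rewrite /K lerDr addr_ge0// sqr_ge0.
have K0 : 0 < K by exact: lt_le_trans K1.
have e'0 : 0 < e / (2 * K) by rewrite divr_gt0// mulr_gt0.
have [u Au hu] := hx _ e'0; have [v Av hv] := hy _ e'0.
exists (a *: u + v); first exact: span_lin.
rewrite inorm_lt//; rewrite inorm_lt// in hu; rewrite inorm_lt// in hv.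
have -> : a *: x + y - (a *: u + v) = a *: (x - u) + (y - v).
  by rewrite scalerBr opprD addrACA.
apply: (le_lt_trans (sqnD_le _ _)); rewrite sqnZ.
set D := (e / (2 * K)) ^+ 2 in hu hv.
have s0 := sqn_ge0 (x - u).
have -> : e ^+ 2 = 4 * K ^+ 2 * D.
  by rewrite /D; field; rewrite lt0r_neq0.
have D0 : 0 < D by rewrite exprn_gt0.
have h1 : (complex.Re a ^+ 2 + complex.Im a ^+ 2) * sqn (x - u) <= (K - 1) * D.
  rewrite /K addrK; apply: ler_wpM2l; last exact: ltW.
  by rewrite addr_ge0// sqr_ge0.
have h2 : K * D <= K ^+ 2 * D.
  by rewrite ler_pM2r// expr2 ler_peMr// ltW.
have h3 : 0 < K ^+ 2 * D by rewrite mulr_gt0// exprn_gt0.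
rewrite mulrBl mul1r in h1; rewrite -(mulrA 4).
set P := (_ * sqn _) in h1 *; set L := K ^+ 2 * D in h2 h3 *.
set M := K * D in h1 h2; clearbody P L M; clear -h1 h2 h3 hv; lra.
Qed.

End InnerTheory.
Arguments icauchy {R E} u.
Arguments icvg {R E} u l.

HB.mixin Record Inner_isSeparableHilbert (R : realType) E of InnerSpace R E := {
  hilbert_complete : forall u : nat -> E, icauchy u -> exists l : E, icvg u l;
  onb : nat -> E;
  onb_orthonormal : forall m n : nat, inner (onb m) (onb n) = (m == n)%:R;
  onb_total : clspan (range onb) = setT
}.

#[short(type=sepHilbertType)]
HB.structure Definition SeparableHilbert (R : realType) :=
  { E of InnerSpace R E & Inner_isSeparableHilbert R E }.

Section Parseval.
Variables (R : realType) (E : sepHilbertType R).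
Implicit Types x y : E.

Definition nsq (a : R[i]) : R := complex.Re a ^+ 2 + complex.Im a ^+ 2.

Definition onb_proj n x : E := \sum_(k < n) inner x (onb k) *: onb k.

Lemma onb_proj_perp n x k : (k < n)%N -> inner (x - onb_proj n x) (onb k) = 0.
Proof.
move=> kn; rewrite innerDl innerNl inner_suml (bigD1 (Ordinal kn))//=.
rewrite innerZl onb_orthonormal eqxx mulr1 big1 ?addr0 ?subrr// => i ik.
rewrite innerZl onb_orthonormal.
have /negbTE -> : (i != k :> nat) by apply: contra ik => /eqP ik; apply/eqP/val_inj.
by rewrite mulr0.
Qed.

Lemma sqn_onb_proj n x : sqn (onb_proj n x) = \sum_(k < n) nsq (inner x (onb k)).
Proof.
elim: n => [|n IH]; first by rewrite /onb_proj !big_ord0 /sqn inner0l.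
rewrite /onb_proj !big_ord_recr/= -/(onb_proj n x) sqnD IH sqnZ.
have -> : inner (onb_proj n x) (inner x (onb n) *: onb n) = 0.
  rewrite innerZr inner_suml big1 ?mulr0// => i _.
  by rewrite innerZl onb_orthonormal ltn_eqF// mulr0.
by rewrite /sqn onb_orthonormal eqxx /= mulr1 mulr0 addr0.
Qed.

Lemma sqn_split n x :
  sqn x = sqn (x - onb_proj n x) + \sum_(k < n) nsq (inner x (onb k)).
Proof.
rewrite -sqn_onb_proj -[in LHS](subrK (onb_proj n x) x) sqnD.
rewrite {3}/onb_proj inner_sumr big1 ?mulr0 ?addr0// => i _.
by rewrite innerZr onb_proj_perp// mulr0.
Qed.

Lemma parseval x :
  \sum_(0 <= k < n) nsq (inner x (onb k)) @[n --> \oo] --> sqn x.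
Proof.
apply/cvgrPdist_lt => e e0.
have xe : clspan (range (onb : nat -> E)) x by rewrite onb_total.
have se0 : 0 < Num.sqrt e by rewrite sqrtr_gt0.
have [y [s hs ->]] := xe _ se0.
rewrite inorm_lt// sqr_sqrtr ?(ltW e0)// => xye.
have [M hM] : exists M, forall p, p \in s -> exists2 k, (k < M)%N & onb k = p.2.
  elim: s hs {xye} => [|q s IH] hs; first by exists 0%N.
  have [|M hM] := IH; first by move=> p ps; apply: hs; rewrite inE ps orbT.
  have [k _ kq] := hs q (mem_head _ _).
  exists (maxn M k.+1) => p; rewrite inE => /predU1P[->|/hM[l lM lp]].
    by exists k => //; rewrite leq_max ltnS leqnn orbT.
  by exists l => //; rewrite leq_max lM.
near=> n.
have Mn : (M <= n)%N by near: n; exact: nbhs_infty_ge.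
rewrite big_mkord.
have -> : sqn x - \sum_(k < n) nsq (inner x (onb k)) = sqn (x - onb_proj n x).
  by rewrite [in LHS](sqn_split n) addrK.
rewrite ger0_norm ?sqn_ge0//; apply: le_lt_trans xye.
set w := \sum_(p <- s) _.
have -> : x - w = (x - onb_proj n x) + (onb_proj n x - w).
  by rewrite addrA subrK.
have rP : inner (x - onb_proj n x) (onb_proj n x) = 0.
  rewrite {2}/onb_proj inner_sumr big1// => i _.
  by rewrite innerZr onb_proj_perp// mulr0.
have rw : inner (x - onb_proj n x) w = 0.
  rewrite /w inner_sumr big1_seq// => p /andP[_ ps].
  have [k kM <-] := hM _ ps.
  by rewrite innerZr onb_proj_perp ?mulr0//; exact: leq_trans Mn.
by rewrite [leRHS]sqnD innerDr innerNr rP rw subrr mulr0 addr0 lerDl sqn_ge0.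
Unshelve. all: by end_near.
Qed.
End Parseval.

Definition circle (R : realType) := {z : R[i] | `|z| == 1}.

Section Circle.
Variable R : realType.

HB.instance Definition _ := SubChoice.on (circle R).

Lemma norm1_circle : `|1 : R[i]| == 1. Proof. by rewrite normr1. Qed.

HB.instance Definition _ := isPointed.Build (circle R) (exist _ 1 norm1_circle).

Definition circle_open : set (set (circle R)) :=
  [set A | exists2 U : set R[i]^o, open U & A = val @^-1` U].

HB.instance Definition _ := @isMeasurable.Build (sigma_display circle_open)
  (circle R) <<s circle_open>> (@sigma_algebra0 _ setT _) (@sigma_algebraC _ _)
  (@sigma_algebra_bigcup _ setT _).

Definition cmeasurable (f : circle R -> R[i]) : Prop :=
  measurable_fun setT (fun xi => complex.Re (f xi)) /\
  measurable_fun setT (fun xi => complex.Im (f xi)).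

Lemma circle_measurable : cmeasurable val.
Proof.
have mopen (g : R[i] -> R) : (forall x y, `|g x - g y|%:C <= `|x - y|) ->
    measurable_fun setT (fun xi : circle R => g (val xi)).
  move=> hg; apply: (measurability _ (RGenOInfty.measurableE R)) => //.
  move=> _ [_ [a ->] <-]; rewrite setTI; apply: sub_sigma_algebra.
  exists (g @^-1` `]a, +oo[%classic : set R[i]^o) => //.
  rewrite openE => x; rewrite /= in_itv/= andbT => ax.
  apply/nbhs_ballP; exists (g x - a)%:C; first by rewrite /= ltcR subr_gt0.
  move=> y; rewrite -ball_normE/= in_itv/= andbT => xy.
  have := le_lt_trans (hg x y) xy; rewrite ltcR.
  by rewrite ltr_distlC => /andP[]; rewrite subKr.
split; apply: mopen => x y.
  apply: le_trans (normc_ge_Re _); by rewrite ReD ReN.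
rewrite normc_def lecR -sqrtr_sqr ler_wsqrtr//.
case: x y => [x1 x2] [y1 y2]/=; by rewrite lerDr sqr_ge0.
Qed.
End Circle.

Section DirectIntegral.
Variables (R : realType) (E : sepHilbertType R).
Variable mu : {finite_measure set (circle R) -> \bar R}.
(* [Some m] is the natural number m and [None] is infinity; the basis [onb] is
   indexed from 0. *)
Variable N : circle R -> option nat.

Definition fiber (xi : circle R) : set E :=
  clspan [set onb n | n in [set n : nat | if N xi is Some m then (n < m)%N else True]].

Definition wmeas (f : circle R -> E) : Prop :=
  forall v : E, cmeasurable (fun xi => inner (f xi) v).

(* Measurability is weak measurability, which for a separable [E] is the same
   as strong measurability. *)
Definition in_dint (f : circle R -> E) : Prop :=
  [/\ wmeas f,
      (\int[mu]_xi (inorm (f xi) ^+ 2)%:E < +oo)%E &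
      \forall xi \ae mu, fiber xi (f xi)].

Definition dint_pred : {pred circle R -> E} := [pred f | `[< in_dint f >]].

Lemma dint_predP f : reflect (in_dint f) (f \in dint_pred).
Proof. exact: asboolP. Qed.

Lemma cmeasD (f g : circle R -> R[i]) : cmeasurable f -> cmeasurable g ->
  cmeasurable (fun xi => f xi + g xi).
Proof.
move=> [f1 f2] [g1 g2]; split.
  by under eq_fun do rewrite ReD; exact: measurable_funD.
by under eq_fun do rewrite ImD; exact: measurable_funD.
Qed.

Lemma cmeasM (f g : circle R -> R[i]) : cmeasurable f -> cmeasurable g ->
  cmeasurable (fun xi => f xi * g xi).
Proof.
move=> [f1 f2] [g1 g2]; split.
  under eq_fun do rewrite ReM.
  by apply: measurable_funB; exact: measurable_funM.
under eq_fun do rewrite ImM.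
by apply: measurable_funD; exact: measurable_funM.
Qed.

Lemma cmeas_cst (c : R[i]) : cmeasurable (fun=> c).
Proof. by split; exact: measurable_cst. Qed.

Lemma wmeasD f g : wmeas f -> wmeas g -> wmeas (f + g).
Proof.
move=> mf mg v; rewrite (_ : (fun _ => _) = (fun xi => inner (f xi) v + inner (g xi) v)).
  exact: cmeasD.
by apply/funext => xi; rewrite -innerDl.
Qed.

Lemma wmeasM (c : circle R -> R[i]) f : cmeasurable c -> wmeas f ->
  wmeas (fun xi => c xi *: f xi).
Proof.
move=> mc mf v; rewrite (_ : (fun _ => _) = (fun xi => c xi * inner (f xi) v)).
  exact: cmeasM.
by apply/funext => xi; rewrite innerZl.
Qed.

Lemma wmeas_sqn f : wmeas f -> measurable_fun setT (fun xi => sqn (f xi)).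
Proof.
move=> mf; pose h n xi := \sum_(0 <= k < n) nsq (inner (f xi) (onb k)).
apply: (@measurable_fun_cvg _ _ _ _ h) => [n|xi _]; last exact: parseval.
apply: measurable_sum => k; have [m1 m2] := mf (onb k).
by apply: measurable_funD; exact: measurable_funX.
Qed.

Lemma sqn_integral_fin f g (a b : R) (h : circle R -> E) :
  wmeas f -> wmeas g -> wmeas h -> 0 <= a -> 0 <= b ->
  (forall xi, sqn (h xi) <= a * sqn (f xi) + b * sqn (g xi)) ->
  (\int[mu]_xi (inorm (f xi) ^+ 2)%:E < +oo)%E ->
  (\int[mu]_xi (inorm (g xi) ^+ 2)%:E < +oo)%E ->
  (\int[mu]_xi (inorm (h xi) ^+ 2)%:E < +oo)%E.
Proof.
move=> mf mg mh a0 b0 hfg.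
under eq_integral do rewrite inorm_sqr.
under [X in _ -> (X < _)%E -> _]eq_integral do rewrite inorm_sqr.
under [X in _ -> _ -> (X < _)%E]eq_integral do rewrite inorm_sqr.
move=> fi gi.
have mf' := wmeas_sqn mf; have mg' := wmeas_sqn mg; have mh' := wmeas_sqn mh.
apply: (@le_lt_trans _ _
  (\int[mu]_xi (a%:E * (sqn (f xi))%:E + b%:E * (sqn (g xi))%:E)))%E.
  apply: ge0_le_integral => //.
  - by move=> xi _; rewrite lee_fin sqn_ge0.
  - exact/measurable_EFinP.
  - by apply: emeasurable_funD; apply: measurable_funeM; exact/measurable_EFinP.
  - by move=> xi _; rewrite -!EFinM -EFinD lee_fin.
rewrite ge0_integralD//=; first last.
- by apply: measurable_funeM; exact/measurable_EFinP.
- by move=> xi _; rewrite lee_fin mulr_ge0// sqn_ge0.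
- by apply: measurable_funeM; exact/measurable_EFinP.
- by move=> xi _; rewrite lee_fin mulr_ge0// sqn_ge0.
rewrite !ge0_integralZl_EFin//; first last.
- exact/measurable_EFinP.
- by move=> xi _; rewrite lee_fin sqn_ge0.
- exact/measurable_EFinP.
- by move=> xi _; rewrite lee_fin sqn_ge0.
by apply: lte_add_pinfty; apply: lte_mul_pinfty.
Qed.

Lemma dint_submod : submod_closed dint_pred.
Proof.
split.
  apply/dint_predP; split.
  - by move=> v; under eq_fun do rewrite inner0l; exact: cmeas_cst.
  - rewrite (eq_integral (cst 0%E)) ?integral0// => xi _.
    by rewrite inorm_sqr /sqn inner0l.
  - by apply/aeW => xi; exact: clspan0.
move=> a f g /dint_predP[mf fi fN] /dint_predP[mg gi gN].
have mh : wmeas (a *: f + g).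
  by apply: wmeasD => //; apply: wmeasM => //; exact: cmeas_cst.
apply/dint_predP; split => //.
- apply: (@sqn_integral_fin f g (2 * nsq a) 2) => //.
    by rewrite mulr_ge0// addr_ge0// sqr_ge0.
  by move=> xi; apply: le_trans (sqnD_le _ _) _; rewrite sqnZ mulrA.
- by apply: filterS2 fN gN => xi; exact: clspan_lin.
Qed.

HB.instance Definition _ := GRing.isSubmodClosed.Build _ _ dint_pred dint_submod.

Record dfun := Dfun { dfun_val :> circle R -> E; _ : dfun_val \in dint_pred }.

HB.instance Definition _ := [isSub for dfun_val].
HB.instance Definition _ := [Choice of dfun by <:].
HB.instance Definition _ := [SubChoice_isSubLmodule of dfun by <:].

Definition dnull : {pred dfun} := [pred f : dfun | `[< \forall xi \ae mu, f xi = 0 >]].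

Lemma dnull_closed : zmod_closed dnull.
Proof.
split; first by apply/asboolP/aeW => xi.
move=> f g /asboolP f0 /asboolP g0; apply/asboolP.
by apply: filterS2 f0 g0 => xi /= fx gx; rewrite -[LHS]/(f xi - g xi) fx gx subrr.
Qed.

HB.instance Definition _ := GRing.isZmodClosed.Build _ dnull dnull_closed.

Definition dint : Type := Quotient.quot dnull.

HB.instance Definition _ := GRing.Zmodule.on dint.

Definition dclass (f : dfun) : dint := \pi_(Quotient.quot dnull)%qT f.
Definition dfun_of (f : dint) : dfun := repr (f : Quotient.quot dnull).

Lemma dclassP (f g : dfun) :
  (\forall xi \ae mu, f xi = g xi) <-> dclass f = dclass g.
Proof.
split=> [fg|/eqP].
  apply/eqP; rewrite /dclass eqmodE /= Quotient.equivE; apply/asboolP.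
  by apply: filterS fg => xi /= fx; rewrite -[LHS]/(f xi - g xi) fx subrr.
rewrite /dclass eqmodE /= Quotient.equivE => /asboolP; apply: filterS => xi /= fx.
by apply/eqP; rewrite -subr_eq0; apply/eqP.
Qed.

Lemma dfun_ofK f : dclass (dfun_of f) = f.
Proof. exact: reprK. Qed.

Lemma dclassK f : \forall xi \ae mu, dfun_of (dclass f) xi = f xi.
Proof. by apply/dclassP; rewrite dfun_ofK. Qed.

Lemma dclassD f g : dclass (f + g) = dclass f + dclass g.
Proof. exact: Quotient.pi_add. Qed.

Definition dscale (a : R[i]) (f : dint) : dint := dclass (a *: dfun_of f).

Lemma dscaleE a f : dscale a (dclass f) = dclass (a *: f).
Proof.
apply/dclassP; apply: filterS (dclassK f) => xi fx.
by rewrite -[LHS]/(a *: dfun_of (dclass f) xi) fx.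
Qed.

Lemma dscaleA a b f : dscale a (dscale b f) = dscale (a * b) f.
Proof. by rewrite -[f]dfun_ofK !dscaleE scalerA. Qed.
Lemma dscale1 : left_id 1 dscale.
Proof. by move=> f; rewrite -[f]dfun_ofK dscaleE scale1r. Qed.
Lemma dscaleDr : right_distributive dscale +%R.
Proof.
move=> a f g; rewrite -[f]dfun_ofK -[g]dfun_ofK -dclassD !dscaleE.
by rewrite -dclassD scalerDr.
Qed.
Lemma dscaleDl f : {morph dscale^~ f : a b / a + b}.
Proof. by move=> a b; rewrite -[f]dfun_ofK !dscaleE -dclassD scalerDl. Qed.

HB.instance Definition _ :=
  GRing.Zmodule_isLmodule.Build R[i] dint dscaleA dscale1 dscaleDr dscaleDl.

Lemma dfun_of_lin a (f g : dint) :
  \forall xi \ae mu, dfun_of (a *: f + g) xi = a *: dfun_of f xi + dfun_of g xi.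
Proof.
have -> : a *: f + g = dclass (a *: dfun_of f + dfun_of g).
  by rewrite dclassD dfun_ofK -[in LHS](dfun_ofK f) -dscaleE.
exact: dclassK.
Qed.

Definition Cintegral (f : circle R -> R[i]) : R[i] :=
  (\int[mu]_xi complex.Re (f xi)) +i* (\int[mu]_xi complex.Im (f xi)).

Definition Cintegrable (f : circle R -> R[i]) : Prop :=
  mu.-integrable setT (fun xi => (complex.Re (f xi))%:E) /\
  mu.-integrable setT (fun xi => (complex.Im (f xi))%:E).

Lemma Cintegral_lin a f g : Cintegrable f -> Cintegrable g ->
  Cintegral (fun xi => a * f xi + g xi) = a * Cintegral f + Cintegral g.
Proof.
move=> [f1 f2] [g1 g2]; case: a => p q.
have IZ r (k : circle R -> R) : mu.-integrable setT (EFin \o k) ->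
    mu.-integrable setT (EFin \o (fun xi => r * k xi)).
  by move=> ik; exact: (integrableZl measurableT r ik).
have IB (k l : circle R -> R) : mu.-integrable setT (EFin \o k) ->
    mu.-integrable setT (EFin \o l) -> mu.-integrable setT (EFin \o (k \- l)).
  by move=> ik il; exact: (integrableB measurableT ik il).
have ID (k l : circle R -> R) : mu.-integrable setT (EFin \o k) ->
    mu.-integrable setT (EFin \o l) -> mu.-integrable setT (EFin \o (k \+ l)).
  by move=> ik il; exact: (integrableD measurableT ik il).
apply/eqP; rewrite eq_complex; apply/andP; split; apply/eqP.
  rewrite ReD ReM /=; under eq_Rintegral do rewrite ReD ReM /=.
  rewrite RintegralD//; [|exact: IB (IZ _ _ f1) (IZ _ _ f2)].
  by rewrite RintegralB ?RintegralZl//; exact: IZ.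
rewrite ImD ImM /=; under eq_Rintegral do rewrite ImD ImM /=.
rewrite RintegralD//; [|exact: ID (IZ _ _ f2) (IZ _ _ f1)].
by rewrite RintegralD ?RintegralZl//; exact: IZ.
Qed.

Lemma Cintegral_ae f g : cmeasurable f -> cmeasurable g ->
  (\forall xi \ae mu, f xi = g xi) -> Cintegral f = Cintegral g.
Proof.
move=> [f1 f2] [g1 g2] fg; rewrite /Cintegral /Rintegral; congr (fine _ +i* fine _).
- apply: ae_eq_integral => //; [exact/measurable_EFinP..|].
  by apply: filterS fg => xi -> _.
- apply: ae_eq_integral => //; [exact/measurable_EFinP..|].
  by apply: filterS fg => xi -> _.
Qed.

Lemma dfun_wmeas (f : dfun) : wmeas f.
Proof. by case: f => f /= /dint_predP[]. Qed.

Lemma dfun_sqn_integrable (f : dfun) :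
  mu.-integrable setT (fun xi => (sqn (f xi))%:E).
Proof.
have mf := wmeas_sqn (dfun_wmeas f).
apply/integrableP; split; first exact/measurable_EFinP.
case: f {mf} => f /= /dint_predP[_ + _]; congr (_ < _)%E.
apply: eq_integral => xi _.
by rewrite ger0_norm ?sqn_ge0// inorm_sqr.
Qed.

Lemma Re_innerE (x y : E) :
  complex.Re (inner x y) = 2^-1 * (sqn (x + y) - sqn x - sqn y).
Proof. by rewrite sqnD; field. Qed.

Lemma Im_innerE (x y : E) : complex.Im (inner x y) = complex.Re (inner x ('i *: y)).
Proof. by rewrite innerZr ReM /= mul0r sub0r mulN1r opprK. Qed.

Lemma Re_inner_integrable (f g : dfun) :
  mu.-integrable setT (fun xi => (complex.Re (inner (f xi) (g xi)))%:E).
Proof.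
under eq_fun do rewrite Re_innerE EFinM.
apply: integrableZl => //.
under eq_fun do rewrite EFinB.
apply: integrableB => //; last exact: dfun_sqn_integrable.
under eq_fun do rewrite EFinB.
apply: integrableB => //; last exact: dfun_sqn_integrable.
exact: (dfun_sqn_integrable (f + g)).
Qed.

Lemma inner_Cintegrable (f g : dfun) :
  Cintegrable (fun xi => inner (f xi) (g xi)).
Proof.
split; first exact: Re_inner_integrable.
under eq_fun do rewrite Im_innerE.
exact: (Re_inner_integrable f ('i *: g)).
Qed.

Lemma inner_cmeasurable (f g : dfun) : cmeasurable (fun xi => inner (f xi) (g xi)).
Proof.
have [/measurable_int h1 /measurable_int h2] := inner_Cintegrable f g.
by split; exact/measurable_EFinP.
Qed.

Definition dinner (f g : dint) : R[i] :=
  Cintegral (fun xi => inner (dfun_of f xi) (dfun_of g xi)).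

Lemma dinner_linl g : scalar (dinner^~ g).
Proof.
move=> a f h; rewrite -Cintegral_lin; [|exact: inner_Cintegrable..].
apply: Cintegral_ae; first exact: inner_cmeasurable.
  apply: cmeasD; last exact: inner_cmeasurable.
  by apply: cmeasM; [exact: cmeas_cst|exact: inner_cmeasurable].
by apply: filterS (dfun_of_lin a f h) => xi ->; rewrite innerDl innerZl.
Qed.

Lemma dinner_herm f g : dinner f g = (-1) ^+ false * Num.conj (dinner g f).
Proof.
rewrite expr0 mul1r /dinner /Cintegral.
apply/eqP; rewrite eq_complex; apply/andP; split; apply/eqP => /=.
  by apply: eq_Rintegral => xi _; rewrite innerC Re_conj.
rewrite -mulN1r -RintegralZl//; last by have [] := inner_Cintegrable (dfun_of g) (dfun_of f).
by apply: eq_Rintegral => xi _; rewrite innerC Im_conj mulN1r.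
Qed.

Lemma dinner_linr f a g h :
  dinner f (a *: g + h) = Num.conj a * dinner f g + dinner f h.
Proof.
rewrite [LHS]dinner_herm dinner_linl [dinner f g]dinner_herm [dinner f h]dinner_herm.
by rewrite !expr0 !mul1r rmorphD rmorphM.
Qed.

Lemma dinner_bilinear :
  bilinear_for ( *%R : GRing.Scale.law R[i] R[i])
    (Num.conj_op \; *%R : GRing.Scale.law R[i] R[i]) dinner.
Proof. by split => [g a f h|f a g h]; [exact: dinner_linl|exact: dinner_linr]. Qed.

Lemma dinner_gt0 f : f != 0 -> 0 < dinner f f.
Proof.
move=> f0.
have If := dfun_sqn_integrable (dfun_of f).
have -> : dinner f f = (\int[mu]_xi sqn (dfun_of f xi))%:C.
  rewrite /dinner /Cintegral; congr (_ +i* _).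
  rewrite (@eq_Rintegral _ _ _ mu setT (cst 0)) ?Rintegral_cst ?mul0r// => xi _.
  by rewrite innerxx.
rewrite ltcR lt_neqAle Rintegral_ge0 ?andbT; last by move=> xi _; exact: sqn_ge0.
apply: contra f0 => /eqP /esym I0; rewrite -[f]dfun_ofK; apply/eqP.
rewrite -[0]dfun_ofK; apply/dclassP.
have I0' : (\int[mu]_xi `|(sqn (dfun_of f xi))%:E| = 0)%E.
  under eq_integral do rewrite gee0_abs ?lee_fin ?sqn_ge0//.
  by rewrite -[LHS]fineK ?integrable_fin_num//; congr _%:E.
have z0 : \forall xi \ae mu, dfun_of (0 : dint) xi = 0 :> E.
  have -> : (0 : dint) = dclass 0.
    by apply: (addrI (dclass 0)); rewrite -dclassD !addr0.
  exact: dclassK.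
have /(ae_eq_integral_abs mu measurableT (measurable_int _ If)) fz := I0'.
apply: filterS2 z0 fz => xi -> /(_ I) [h]; exact: sqn_eq0.
Qed.

HB.instance Definition _ :=
  @bilinear_isBilinear.Build _ _ _ _ _ _ dinner dinner_bilinear.
HB.instance Definition _ :=
  @isHermitianSesquilinear.Build _ _ false Num.conj_op dinner dinner_herm.
HB.instance Definition _ := @isDotProduct.Build _ _ dinner dinner_gt0.
HB.instance Definition _ :=
  @Lmodule_hasInner.Build R dint (dinner : {dot dint for Num.conj_op}).

Lemma dmul_subproof (f : dfun) :
  (fun xi => val xi *: f xi : E) \in dint_pred.
Proof.
have mf : wmeas (fun xi => val xi *: f xi : E).
  by apply: wmeasM; [exact: circle_measurable|exact: dfun_wmeas].
have nE xi : sqn (val xi *: f xi : E) = sqn (f xi).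
  rewrite sqnZ; have := add_Re2_Im2 (val xi); rewrite (eqP (valP xi)) expr1n => /complexI ->; exact: mul1r.
have [_ fi fN] : in_dint f by case: (f) => g /= /dint_predP.
apply/dint_predP; split => //.
  by under eq_integral do rewrite inorm_sqr nE -inorm_sqr.
apply: filterS fN => xi fx.
by rewrite -[_ *: _]addr0; apply: clspan_lin => //; exact: clspan0.
Qed.

(* multiplication by the independent variable *)
Definition dmul (f : dint) : dint := dclass (Dfun (dmul_subproof (dfun_of f))).

Lemma dmulE (f : dint) : \forall xi \ae mu, dfun_of (dmul f) xi = val xi *: dfun_of f xi.
Proof. exact: dclassK. Qed.

End DirectIntegral.

Arguments dint {R} E mu N.
Arguments dmul {R E mu N} f.

Section StandardInner.
Variables (R : realType) (d : nat).

Definition cinner (x y : 'cV[R[i]]_d) : R[i] :=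
  \sum_(k < d) x k 0 * Num.conj (y k 0).

Lemma cinner_herm x y : cinner x y = (-1) ^+ false * Num.conj (cinner y x).
Proof.
rewrite expr0 mul1r /cinner rmorph_sum; apply: eq_bigr => k _.
by rewrite rmorphM mulrC /= conjCK.
Qed.

Lemma cinner_linl y : scalar (cinner^~ y).
Proof.
move=> a u v; rewrite /cinner mulr_sumr -big_split; apply: eq_bigr => k _ /=.
by rewrite !mxE mulrDl mulrA.
Qed.

Lemma cinner_bilinear :
  bilinear_for ( *%R : GRing.Scale.law R[i] R[i])
    (Num.conj_op \; *%R : GRing.Scale.law R[i] R[i]) cinner.
Proof.
split => [y a u v|x a u v]; first exact: cinner_linl.
rewrite cinner_herm cinner_linl [cinner x u]cinner_herm [cinner x v]cinner_herm.
by rewrite !expr0 !mul1r rmorphD rmorphM.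
Qed.

Lemma cinner_gt0 x : x != 0 -> 0 < cinner x x.
Proof.
have c0 k : 0 <= x k 0 * Num.conj (x k 0) by rewrite mul_conjC_ge0.
rewrite lt_def /cinner sumr_ge0// andbT; apply: contra => /eqP s0.
apply/eqP/colP => k; rewrite mxE; apply/eqP; rewrite -mul_conjC_eq0.
by have /(_ k isT) -> := psumr_eq0P (fun k _ => c0 k) s0.
Qed.

HB.instance Definition _ :=
  @bilinear_isBilinear.Build _ _ _ _ _ _ cinner cinner_bilinear.
HB.instance Definition _ :=
  @isHermitianSesquilinear.Build _ _ false Num.conj_op cinner cinner_herm.
HB.instance Definition _ := @isDotProduct.Build _ _ cinner cinner_gt0.
HB.instance Definition _ := @Lmodule_hasInner.Build R 'cV[R[i]]_d
  (cinner : {dot 'cV[R[i]]_d for Num.conj_op}).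

End StandardInner.

Section Operators.
Variable R : realType.
Implicit Types X Y : innerType R.

(* The adjoint of the restriction of [A] to the subspace [D], as an operator
   from [Y] to [D] *)
Definition adj_on X Y (D : set X) (A : X -> Y) : Y -> X :=
  fun y => xget 0 [set w | D w /\ forall h, D h -> inner (A h) y = inner h w].

Definition adj X Y (A : X -> Y) : Y -> X := adj_on setT A.

Definition isometric X Y (A : X -> Y) : Prop := forall x, inorm (A x) = inorm x.

Definition contractive X Y (A : X -> Y) : Prop :=
  linear A /\ forall x, inorm (A x) <= inorm x.

Definition strictly_contractive X Y (A : X -> Y) : Prop :=
  linear A /\ forall x, x != 0 -> inorm (A x) < inorm x.

(* [0 <= inner (S x) x] contains the statement that this number is real, so
   that [S] is self-adjoint *)
Definition positive X (S : X -> X) : Prop :=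
  linear S /\ forall x, 0 <= inner (S x) x.

Definition sqrtop X (A : X -> X) : X -> X :=
  xget (fun=> 0) [set S : X -> X | positive S /\ forall x, S (S x) = A x].

Definition invop X (A : X -> X) : X -> X :=
  xget (fun=> 0) [set S : X -> X | cancel S A /\ cancel A S].

Definition defect X (A : X -> X) : X -> X :=
  sqrtop (fun x => x - adj A (A x)).
Definition defect_adj X (A : X -> X) : X -> X :=
  sqrtop (fun x => x - A (adj A x)).

Definition defect_space X (A : X -> X) : set X := iclosure (range (defect A)).
Definition defect_adj_space X (A : X -> X) : set X :=
  iclosure (range (defect_adj A)).

(* [V], restricted to the subspace [D], is a unitary operator onto [Y] *)
Definition unitary_on X Y (D : set X) (V : X -> Y) : Prop :=
  [/\ forall (a : R[i]) x y, D x -> D y -> V (a *: x + y) = a *: V x + V y,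
      forall x, D x -> inorm (V x) = inorm x &
      V @` D = setT].

(* The coordinate operators [V] and [Vs] matter only on [defect_space T] and
   [defect_adj_space T], respectively. *)
Definition char_fun X Y Ys (T : X -> X) (V : X -> Y) (Vs : X -> Ys)
    (z : R[i]) (y : Y) : Ys :=
  let w := adj_on (defect_space T) V y in
  Vs (- T w +
      z *: defect_adj T (invop (fun x => x - z *: adj T x) (defect T w))).

Definition perturbation X (d : nat) (U : X -> X) (B : 'cV[R[i]]_d -> X)
    (Gam : 'M[R[i]]_d) : X -> X :=
  fun f => U f + B ((Gam - 1%:M) *m adj B (U f)).

End Operators.

Section F1.
Variables (R : realType) (E : sepHilbertType R).
Variables (mu : {finite_measure set (circle R) -> \bar R}) (d : nat).
Variables (N : circle R -> option nat) (B : 'cV[R[i]]_d -> dint E mu N).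

Definition bcol (k : 'I_d) : circle R -> E := dfun_of (B (delta_mx k 0)).

(* the matrix B(xi)^* B(xi) *)
Definition gram (xi : circle R) : 'M[R[i]]_d :=
  \matrix_(j, k) inner (bcol k xi) (bcol j xi).

Definition F1 (z : R[i]) : 'M[R[i]]_d :=
  \matrix_(j, k) Cintegral mu (fun xi =>
    z * Num.conj (val xi) / (1 - z * Num.conj (val xi)) * gram xi j k).

End F1.

(* Main.v *)
Require Import Defs.
From HB Require Import structures.
From mathcomp Require Import all_boot all_order all_algebra.
From mathcomp Require Import all_classical all_reals all_analysis.
From mathcomp Require Import measurable_realfun complex ring lra.
Set Implicit Arguments. Unset Strict Implicit. Unset Printing Implicit Defensive.
Import Order.TTheory GRing.Theory Num.Theory.
Local Open Scope classical_set_scope.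
Local Open Scope ring_scope.
Local Open Scope complex_scope.

(** Write [W] for [U^-1 = U^*] (multiplication by the conjugate variable),
    [C = Gam^* - 1] and [J = W B]. On the orthogonal complement of [Ran B] the
    factor [1 + B (Gam - 1) B^*] of [T] is the identity, and on [Ran B] it acts as
    [Gam]. Such operators multiply like the matrices that define them
    ([act_on_rangeM]), so that
    [1 - T^* T = J (1 - Gam^* Gam) J^*] and [1 - T T^* = B (1 - Gam Gam^* ) B^*].

    The defect operators are therefore [D_T = J D_Gam J^*] and
    [D_{T^*} = B D_{Gam^*} B^*], once positive square roots are known to be unique
    ([sqrtop_iso]). For this, let [S] be any positive square root of [J D^2 J^*]
    with [D] positive. An eigenvector of [S^2] for [a^2], with [a >= 0], is an
    eigenvector of [S] for [a] ([positive_sqrt_eigen]); the images under [J] of an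
    eigenbasis of [D], together with the kernel of [J^*], then determine [S].
    As [Gam] is strict, [D_Gam] and [D_{Gam^*}] are invertible. The defect spaces
    are thus [Ran J] and [Ran B], on which [J^* = B^* U] and [B^*] are unitary.

    Let now [Q] be multiplication by [z xi^-1 / (1 - z xi^-1)], a bounded function
    for [|z| < 1]. It satisfies [(1 - z W) Q = z W], and [F_1(z) = B^* Q B]
    ([F1_mul]). If [h] solves [(1 - z T^* ) h = J v], where [T^* = W (1 + B C B^* )],
    then [(1 - z W) (z h) = z W B (C B^* (z h) + v)]. Because [1 - z W] is injective,
    [z h = Q B (C B^* (z h) + v)], and applying [B^*] leaves the finite system
    [(1 - F_1 C) (z B^* h) = F_1 v]. With [v = D_Gam x] this is the second formula
    for the characteristic function ([char_fun_perturbation]); the first one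
    follows from [F (1 - CF)^-1 = (1 - FC)^-1 F] ([push_through]). Finally,
    [1 - F_1 C] is invertible because a kernel vector [u] would give the fixed
    point [h = Q B C u] of the strict contraction [z T^*] ([one_sub_FC_unit]). *)

(** * Inner product spaces *)

Section Inner.
Variable R : realType.
Implicit Types X Y Z : innerType R.

Lemma sqn_le_inorm X Y (x : X) (y : Y) : (inorm x <= inorm y) = (sqn x <= sqn y).
Proof. by rewrite -!inorm_sqr ler_pXn2r// nnegrE inorm_ge0. Qed.

Lemma sqn_lt_inorm X Y (x : X) (y : Y) : (inorm x < inorm y) = (sqn x < sqn y).
Proof. by rewrite -!inorm_sqr ltr_pXn2r// nnegrE inorm_ge0. Qed.

(** An instance of [linearZ] whose right-hand side carries the scaling of the
    inner product spaces themselves, so that [innerZl] and [innerZr] apply to it. *)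
Lemma linZ X Y (f : {linear X -> Y}) a x : f (a *: x) = a *: f x.
Proof. by rewrite linearZ_LR. Qed.

Lemma isometric_sqn X Y (A : X -> Y) : isometric A -> forall x, sqn (A x) = sqn x.
Proof. by move=> hA x; rewrite -!inorm_sqr hA. Qed.

(** Polarization: the norm determines the real part of the inner product, and
    [Im (x, y) = Re (x, i y)]. *)
Lemma isometric_inner X Y (A : {linear X -> Y}) : isometric A ->
  forall x y, inner (A x) (A y) = inner x y.
Proof.
move=> /isometric_sqn hA.
have ReA x y : complex.Re (inner (A x) (A y)) = complex.Re (inner x y).
  by have := hA (x + y); rewrite linearD !sqnD !hA; lra.
move=> x y; apply/eqP; rewrite eq_complex ReA eqxx andTb.
have ImE Z (u v : Z) : complex.Im (inner u v) = complex.Re (inner u ('i *: v)).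
  by rewrite innerZr Defs.ReM /= mul0r sub0r mulN1r opprK.
by rewrite !ImE -linZ ReA.
Qed.

Lemma inner_injr X (x y : X) : (forall w, inner w x = inner w y) -> x = y.
Proof.
move=> h; apply/eqP; rewrite -subr_eq0; apply/eqP/sqn_eq0.
by rewrite /sqn innerDr innerNr h subrr.
Qed.

(** Adjoints are defined by choice; nondegeneracy of the inner product makes the
    chosen value unique, so exhibiting one adjoint computes [adj]. *)
Lemma adjE X Y (A : X -> Y) (A' : Y -> X) :
  (forall x y, inner (A x) y = inner x (A' y)) -> adj A = A'.
Proof.
move=> h; apply/funext => y; apply: xget_unique; first by split.
by move=> w [_ hw]; apply: inner_injr => x; rewrite -h hw.
Qed.

Lemma linear_bundle (X Y : lmodType R[i]) (f : X -> Y) : linear f ->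
  exists g : {linear X -> Y}, g = f :> (X -> Y).
Proof.
move=> lf; pose l := GRing.isLinear.Build R[i] X Y *:%R f lf.
by pose g : {linear X -> Y} := HB.pack f l; exists g.
Qed.

(** Complex polarization: reality of [(S x, x)] at [x + y] relates the imaginary
    parts of [(S x, y)] and [(S y, x)], and replacing [y] by [i y] turns this into
    the relation between the real parts. *)
Lemma positive_sym X (S : X -> X) : positive S ->
  forall x y, inner (S x) y = inner x (S y).
Proof.
move=> [/linear_bundle[g <-] pg].
have Im0 x : complex.Im (inner (g x) x) = 0 by exact/ger0_Im.
have ImC x y : complex.Im (inner (g x) y) = - complex.Im (inner (g y) x).
  by have := Im0 (x + y); rewrite linearD innerDl !innerDr !Defs.ImD !Im0; lra.
move=> x y; rewrite [RHS]innerC; apply/eqP; rewrite eq_complex Defs.Re_conj Defs.Im_conj.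
rewrite ImC eqxx andbT; apply/eqP.
have := ImC x ('i *: y); rewrite linZ innerZl innerZr !Defs.ImM /=; lra.
Qed.

(** For [a > 0], the vector [w = S v - a v] satisfies [S w = - a w], which
    positivity of [S] allows only for [w = 0]. For [a = 0] one has
    [(S v, S v) = (S^2 v, v) = 0]. *)
Lemma positive_sqrt_eigen X (S : X -> X) (a : R[i]) v : positive S -> 0 <= a ->
  S (S v) = a ^+ 2 *: v -> S v = a *: v.
Proof.
move=> pS a0 SSv; have [/linear_bundle[g gS] Sge0] := pS; rewrite -gS in SSv *.
have [a00|an0] := eqVneq a 0.
  rewrite a00 scale0r; apply: sqn_eq0.
  by rewrite gS /sqn (positive_sym pS) -gS SSv a00 expr0n scale0r inner0r.
set w := g v - a *: v.
have Sw : g w = - (a *: w).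
  by rewrite /w linearB linZ SSv scalerBr scalerA opprB.
have w0 : w = 0.
  apply/eqP; rewrite -(dnorm_eq0 inner) eq_le dnorm_ge0 andbT.
  have := Sge0 w; rewrite -gS Sw innerNl innerZl oppr_ge0 pmulr_rle0//.
  by rewrite lt_neqAle eq_sym an0.
by apply/eqP; rewrite -subr_eq0 -/w w0.
Qed.

Lemma sqn_orth X (x y : X) : inner x y = 0 -> sqn (x + y) = sqn x + sqn y.
Proof. by move=> xy; rewrite sqnD xy mulr0 addr0. Qed.

Lemma fixed_scaled_eq0 X (A : X -> X) z x : (forall y, sqn (A y) <= sqn y) ->
  `|z| < 1 -> x = z *: A x -> x = 0.
Proof.
move=> Ale z1 xE; apply: sqn_eq0; apply/eqP; rewrite eq_le sqn_ge0 andbT.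
have n1 : nsq z < 1.
  have := add_Re2_Im2 z; rewrite -/(nsq z) => nE.
  by rewrite -ltcR nE expr_lt1.
have n0 : 0 <= nsq z by rewrite addr_ge0 ?sqr_ge0.
have h : sqn x <= nsq z * sqn x by rewrite {1}xE sqnZ ler_wpM2l.
by have : (1 - nsq z) * sqn x <= 0; [lra|rewrite pmulr_rle0 ?subr_gt0].
Qed.

Lemma invopK X (A : X -> X) : bijective A -> cancel (invop A) A.
Proof.
case=> g Ag gA; rewrite /invop.
by case: xgetP => [S _ []//|/(_ g)]; case.
Qed.

End Inner.

(** * Matrices and positive square roots *)

Lemma hermitian_mx_diag (C : numClosedFieldType) d (M : 'M[C]_d) :
  map_mx Num.conj M^T = M ->
  exists (P : 'M[C]_d) (a : 'rV[C]_d), P *m map_mx Num.conj P^T = 1%:M /\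
    M = map_mx Num.conj P^T *m diag_mx a *m P.
Proof.
move=> Mh; have Mn : M \is normalmx by apply/normalmxP; rewrite Mh.
exists (spectralmx M), (spectral_diag M); split.
  exact/unitarymxP/spectral_unitarymx.
by rewrite -[map_mx _ _]invmx_unitary ?spectral_unitarymx//; exact/orthomx_spectralP.
Qed.

(** The identity is [(1 - FC) F = F (1 - CF)] multiplied by both inverses.
    Regrouping the formal Neumann series of [(1 - CF)^-1] suggests the inverse
    [1 + C (1 - FC)^-1 F]. *)
Lemma push_through (K : comUnitRingType) d (F C : 'M[K]_d) :
  1%:M - F *m C \in unitmx ->
  1%:M - C *m F \in unitmx /\
  F *m invmx (1%:M - C *m F) = invmx (1%:M - F *m C) *m F.
Proof.
move=> uFC; set L := invmx (1%:M - F *m C).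
have CFL : (1%:M - C *m F) *m (C *m L *m F) = C *m F.
  have -> : (1%:M - C *m F) *m (C *m L *m F) =
      C *m ((1%:M - F *m C) *m L) *m F.
    by rewrite !mulmxA mulmxBr mulmxBl mulmx1 mul1mx !mulmxA.
  by rewrite mulmxV// mulmx1.
have [uCF _] : 1%:M - C *m F \in unitmx /\ 1%:M + C *m L *m F \in unitmx.
  by apply: mulmx1_unit; rewrite mulmxDr mulmx1 CFL subrK.
split=> //; apply: (canRL (mulKmx uFC)).
have e : (1%:M - F *m C) *m F = F *m (1%:M - C *m F).
  by rewrite mulmxBl mulmxBr mul1mx mulmx1 mulmxA.
by rewrite mulmxA e mulmxK.
Qed.

Section Matrices.
Variables (R : realType) (d : nat).
Implicit Types (M P : 'M[R[i]]_d) (x y : 'cV[R[i]]_d).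

Definition mxadj M : 'M[R[i]]_d := map_mx Num.conj M^T.

Lemma mxadjK M : mxadj (mxadj M) = M.
Proof. by apply/matrixP => i j; rewrite !mxE conjCK. Qed.

Lemma cinnerE x y : inner x y = \sum_k x k 0 * Num.conj (y k 0).
Proof. by []. Qed.

Lemma inner_mulmx M x y : inner (M *m x) y = inner x (mxadj M *m y).
Proof.
rewrite !cinnerE; under eq_bigr do rewrite mxE mulr_suml.
rewrite exchange_big; apply: eq_bigr => k _ /=.
rewrite mxE rmorph_sum mulr_sumr; apply: eq_bigr => j _ /=.
rewrite !mxE rmorphM /= conjCK; ring.
Qed.

Lemma inner_delta_r x j : inner x (delta_mx j 0) = x j 0.
Proof.
rewrite cinnerE (bigD1 j)//= big1 ?addr0 => [|k kj].
  by rewrite mxE !eqxx rmorph1 mulr1.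
by rewrite mxE (negbTE kj) rmorph0 mulr0.
Qed.

Lemma inner_delta M i j : inner (M *m delta_mx i 0) (delta_mx j 0) = M j i.
Proof. by rewrite inner_delta_r -colE mxE. Qed.

(** The unitary diagonalization of a Hermitian matrix; the [i]-th eigenvalue is
    the value of the quadratic form of [M] at the [i]-th column of [P^*], hence
    nonnegative. *)
Lemma positive_mx_diag M : positive (mulmx M : 'cV_d -> 'cV_d) ->
  exists (P : 'M[R[i]]_d) (a : 'I_d -> R[i]),
    [/\ P *m mxadj P = 1%:M, forall i, 0 <= a i &
        M = mxadj P *m diag_mx (\row_i a i) *m P].
Proof.
move=> pM.
have Mh : mxadj M = M.
  apply/matrixP => i j; have := positive_sym pM (delta_mx j 0) (delta_mx i 0).
  by rewrite inner_delta innerC inner_delta !mxE => <-.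
have [P [a [PP ME]]] : exists (P : 'M[R[i]]_d) (a : 'rV[R[i]]_d),
  P *m mxadj P = 1%:M /\ M = mxadj P *m diag_mx a *m P := hermitian_mx_diag Mh.
have PP' : mxadj P *m P = 1%:M by exact: mulmx1C.
exists P, (a 0); split=> // [i|]; last first.
  by rewrite [LHS]ME; congr (_ *m diag_mx _ *m _); apply/rowP => i; rewrite mxE.
have [_ /(_ (mxadj P *m delta_mx i 0))] := pM.
pose e : 'cV[R[i]]_d := delta_mx i 0; rewrite -[delta_mx i 0]/e.
have -> : M *m (mxadj P *m e) = mxadj P *m (diag_mx a *m e).
  by rewrite {1}ME !mulmxA -[_ *m P *m _]mulmxA PP mulmx1.
rewrite inner_mulmx mxadjK [P *m _]mulmxA PP mul1mx inner_delta mxE eqxx.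
by rewrite mulr1n.
Qed.

Lemma positive_mx_sqrt M : positive (mulmx M : 'cV_d -> 'cV_d) ->
  exists2 D : 'M[R[i]]_d, positive (mulmx D : 'cV_d -> 'cV_d) & D *m D = M.
Proof.
move=> /positive_mx_diag[P [a [PP a0 ->]]].
pose S := diag_mx (\row_i sqrtC (a i)).
exists (mxadj P *m S *m P).
  split=> [c u v|x]; first by rewrite linearP.
  rewrite -!mulmxA inner_mulmx mxadjK cinnerE sumr_ge0// => k _.
  rewrite mul_diag_mx !mxE -mulrA mulr_ge0 ?sqrtC_ge0//.
  by rewrite mul_conjC_ge0.
rewrite !mulmxA -(mulmxA _ P) PP mulmx1 -(mulmxA _ S S) mulmx_diag.
by congr (_ *m diag_mx _ *m _); apply/rowP => i; rewrite !mxE -expr2 sqrtCK.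
Qed.

Lemma injective_unitmx M : (forall x, M *m x = 0 -> x = 0) -> M \in unitmx.
Proof.
move=> Minj; rewrite -row_full_unit -cokermx_eq0; apply/eqP/matrixP => i j.
have := Minj (col j (cokermx M)).
by rewrite colE mulmxA mulmx_coker mul0mx -colE => /(_ erefl)/colP/(_ i); rewrite !mxE.
Qed.

End Matrices.

(** * Isometries from a finite-dimensional space *)

Section Isometry.
Variables (R : realType) (X : innerType R) (d : nat).
Variable J : {linear 'cV[R[i]]_d -> X}.
Hypothesis isoJ : isometric J.

(** Finite dimension of the source provides the adjoint: its [k]-th coordinate
    at [x] is the inner product of [x] with the image of the [k]-th basis vector. *)
Lemma adj_cV x y : inner (J y) x = inner y (adj J x).
Proof.
pose A x : 'cV[R[i]]_d := \col_k inner x (J (delta_mx k 0)).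
suff h u v : inner (J u) v = inner u (A v) by rewrite (adjE h) h.
rewrite [u in LHS]matrix_sum_delta linear_sum inner_suml cinnerE.
apply: eq_bigr => k _; rewrite big_ord1 linZ innerZl mxE.
by rewrite [inner v _]innerC conjCK.
Qed.

Lemma adj_cV_linear : linear (adj J).
Proof.
by move=> a x y; apply: inner_injr => w; rewrite -adj_cV !innerDr !innerZr !adj_cV.
Qed.

Lemma adj_isoK y : adj J (J y) = y.
Proof. by apply: inner_injr => w; rewrite -adj_cV isometric_inner. Qed.

HB.instance Definition _ := GRing.isLinear.Build R[i] X 'cV[R[i]]_d *:%R (adj J)
  adj_cV_linear.

Lemma adj_iso_perp x y : inner (x - J (adj J x)) (J y) = 0.
Proof. by rewrite innerC adj_cV linearB /= adj_isoK subrr inner0r rmorph0. Qed.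

(** [J J^* x] is the best approximation of [x] in [Ran J], by Pythagoras; a limit
    of elements of [Ran J] is therefore equal to its own projection. *)
Lemma iclosure_range_iso : iclosure (range J) = range J.
Proof.
apply/seteqP; split=> x; last first.
  move=> Jx e e0; exists x => //.
  by rewrite subrr /inorm /sqn inner0l sqrtr0.
move=> xJ; exists (adj J x) => //; apply/eqP; rewrite eq_sym -subr_eq0; apply/eqP.
apply: sqn_eq0; apply/eqP; rewrite eq_le sqn_ge0 andbT; apply/ler_addgt0Pl => e e0.
have se0 : 0 < Num.sqrt e by rewrite sqrtr_gt0.
have [_ [y _ <-]] := xJ _ se0.
rewrite inorm_lt// sqr_sqrtr ?(ltW e0)// addr0 => /ltW; apply: le_trans.
have -> : x - J y = (x - J (adj J x)) + J (adj J x - y).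
  by rewrite linearB addrA subrK.
by rewrite sqn_orth ?adj_iso_perp// lerDl sqn_ge0.
Qed.

(** On [Ran J] the adjoint of an isometry is its inverse. *)
Lemma unitary_on_adj_iso : unitary_on (range J) (adj J).
Proof.
split=> [a x y _ _|_ [y _ <-]|]; first by rewrite linearP.
  by rewrite adj_isoK isoJ.
by rewrite -subTset => y _; exists (J y); [exists y|rewrite adj_isoK].
Qed.

Lemma adj_on_adj_iso : adj_on (range J) (adj J) = J.
Proof.
apply/funext => y; apply: xget_unique.
  by split=> [|_ [h _ <-]]; [exists y|rewrite adj_isoK isometric_inner].
move=> _ [[w _ <-] hw]; congr (J _); apply: inner_injr => h.
by have := hw (J h); rewrite adj_isoK isometric_inner// => ->//.
Qed.

Section SquareRoot.
Variable D : 'M[R[i]]_d.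
Hypothesis pD : positive (mulmx D : 'cV_d -> 'cV_d).

(** A positive square root of [J D^2 J^*] is known on the orthogonal sum of
    [Ran J], spanned by the images of eigenvectors of [D], and [ker J^*], where its
    square vanishes; [positive_sqrt_eigen] applies to both kinds of vectors. *)
Lemma sqrtop_iso :
  sqrtop (fun x => J (D *m (D *m adj J x))) = (fun x => J (D *m adj J x)).
Proof.
apply: xget_unique.
  split=> [|x]; last by rewrite adj_isoK.
  split=> [a x y|x]; last by rewrite adj_cV; exact: pD.2.
  by rewrite !linearP.
move=> S [pS SS]; have [/linear_bundle[g gS] _] := pS; rewrite -gS.
have [P [a [PP a0 DE]]] := positive_mx_diag pD.
have PP' : mxadj P *m P = 1%:M by exact: mulmx1C.
have gJ y : g (J y) = J (D *m y).
  have -> : y = mxadj P *m (P *m y) by rewrite mulmxA PP' mul1mx.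
  set c := P *m y; rewrite [c]matrix_sum_delta !linear_sum; apply: eq_bigr => k _ /=.
  rewrite big_ord1 -!scalemxAr !linZ; congr (_ *: _).
  pose e : 'cV[R[i]]_d := delta_mx k 0; rewrite -[delta_mx k 0]/e.
  (* the columns of [P^*] are the eigenvectors of [D] *)
  have DP : D *m (mxadj P *m e) = a k *: (mxadj P *m e).
    rewrite {1}DE !mulmxA -[_ *m P *m _]mulmxA PP mulmx1 -[_ *m e]mulmxA.
    rewrite scalemxAr; congr (_ *m _); apply/colP => j.
    rewrite mul_diag_mx !mxE eqxx andbT.
    by have [->//|_] := eqVneq j k; rewrite !mulr0.
  rewrite DP linZ gS; apply: positive_sqrt_eigen => //.
  by rewrite SS adj_isoK DP -scalemxAr DP scalerA linZ.
(* on [ker J^*] the square of [S] is 0, whence the eigenvalue 0 *)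
apply/funext => x.
have {1}-> : x = (x - J (adj J x)) + J (adj J x) by rewrite subrK.
rewrite linearD gJ gS (@positive_sqrt_eigen _ _ _ 0 _ pS) ?scale0r ?add0r//.
by rewrite SS linearB /= adj_isoK subrr !mulmx0 linear0 expr0n scale0r.
Qed.

Lemma range_iso_unit : D \in unitmx -> range (fun x => J (D *m adj J x)) = range J.
Proof.
move=> uD; apply/seteqP; split=> _ [y _ <-]; first by exists (D *m adj J y).
by exists (J (invmx D *m y)) => //; rewrite adj_isoK mulKVmx.
Qed.
End SquareRoot.

End Isometry.

(** * Defect operators of a strictly contractive matrix *)

Section StrictContraction.
Variables (R : realType) (d : nat).
Implicit Types (G D : 'M[R[i]]_d).

Lemma adj_mulmx G : adj (mulmx G : 'cV_d -> 'cV_d) = mulmx (mxadj G).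
Proof. exact/adjE/inner_mulmx. Qed.

(** With [y = G^* x], expanding [0 <= |x - G y|^2] gives
    [2 |y|^2 <= |x|^2 + |G y|^2], and [|G y| < |y|] unless [y = 0]. *)
Lemma strictly_contractive_adj G :
  strictly_contractive (mulmx G : 'cV_d -> 'cV_d) ->
  strictly_contractive (mulmx (mxadj G) : 'cV_d -> 'cV_d).
Proof.
move=> [_ sG]; split=> [a x y|x x0]; first by rewrite linearP.
rewrite sqn_lt_inorm; set y := mxadj G *m x.
have [y0|/sG] := eqVneq y 0.
  rewrite y0 /sqn inner0l lt_neqAle -/(sqn x) sqn_ge0 andbT eq_sym.
  by apply: contra x0 => /eqP/sqn_eq0 ->.
have := sqn_ge0 (x - G *m y); rewrite sqnD sqnN innerNr Defs.ReN.
rewrite innerC Defs.Re_conj inner_mulmx -/y -/(sqn y) sqn_lt_inorm; lra.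
Qed.

Lemma strictly_contractive_sqn G :
  strictly_contractive (mulmx G : 'cV_d -> 'cV_d) ->
  forall x : 'cV_d, sqn (G *m x) <= sqn x.
Proof.
move=> [_ sG] x; have [->|/sG] := eqVneq x 0; first by rewrite mulmx0.
by rewrite sqn_lt_inorm => /ltW.
Qed.

(** [((1 - G^* G) x, x) = |x|^2 - |G x|^2] is positive for [x <> 0], which gives
    the square root and its invertibility. The link with [defect] is [sqrtop_iso]
    for the identity isometry. *)
Lemma defect_matrix G : strictly_contractive (mulmx G : 'cV_d -> 'cV_d) ->
  exists D, [/\ positive (mulmx D : 'cV_d -> 'cV_d), D *m D = 1%:M - mxadj G *m G,
    D \in unitmx & defect (mulmx G : 'cV_d -> 'cV_d) = mulmx D].
Proof.
move=> sG; have inE (x : 'cV_d) :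
    inner ((1%:M - mxadj G *m G) *m x) x = (sqn x - sqn (G *m x))%:C.
  rewrite mulmxBl mul1mx innerDl innerNl -mulmxA inner_mulmx mxadjK !innerxx.
  by rewrite rmorphB.
have /positive_mx_sqrt[D pD DE] : positive (mulmx (1%:M - mxadj G *m G) : 'cV_d -> 'cV_d).
  split=> [a x y|x]; first by rewrite linearP.
  by rewrite inE ler0c subr_ge0 strictly_contractive_sqn.
exists D; split=> //.
  apply: injective_unitmx => x Dx; apply/eqP; apply: contraT => /sG.2.
  rewrite sqn_lt_inorm -subr_gt0.
  suff -> : sqn x - sqn (G *m x) = 0 by rewrite ltxx.
  by apply: complexI; rewrite -inE -DE -mulmxA Dx mulmx0 inner0l.
pose J : {linear 'cV[R[i]]_d -> 'cV[R[i]]_d} := idfun.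
have aJ : adj J = id by exact: adjE.
have isoJ : isometric J by [].
have := sqrtop_iso isoJ pD; rewrite aJ; apply: etrans; rewrite /defect adj_mulmx.
congr sqrtop; apply/funext => x /=.
by rewrite [RHS]mulmxA DE mulmxBl mul1mx mulmxA.
Qed.

Lemma defect_adj_mulmx G : defect_adj (mulmx G : 'cV_d -> 'cV_d) =
  defect (mulmx (mxadj G) : 'cV_d -> 'cV_d).
Proof. by rewrite /defect !adj_mulmx mxadjK /defect_adj adj_mulmx. Qed.

End StrictContraction.

(** * Operators acting on the range of an isometry *)

Section ActionOnRange.
Variables (R : realType) (X : innerType R) (d : nat).
Variable B : {linear 'cV[R[i]]_d -> X}.
Hypothesis isoB : isometric B.
Implicit Types (G H : 'M[R[i]]_d) (x y : X).

(** [G] transported to [Ran B], extended by the identity on the orthogonal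
    complement; this is the factor of [T] to the left of [U]. *)
Definition act_on_range G x : X := x + B ((G - 1%:M) *m adj B x).

Lemma adj_act_on_range G x : adj B (act_on_range G x) = G *m adj B x.
Proof. by rewrite /act_on_range linearD /= adj_isoK// mulmxBl mul1mx addrC subrK. Qed.

Lemma act_on_range_linear G : linear (act_on_range G).
Proof.
move=> a x y; rewrite /act_on_range linearP /= mulmxDr -scalemxAr linearP.
by rewrite scalerDr addrACA.
Qed.

HB.instance Definition _ G := GRing.isLinear.Build R[i] X X *:%R (act_on_range G)
  (@act_on_range_linear G).

Lemma act_on_rangeM G H x : act_on_range G (act_on_range H x) = act_on_range (G *m H) x.
Proof.
rewrite {1}/act_on_range adj_act_on_range {1}/act_on_range /act_on_range -addrA -linearD.
by rewrite mulmxA -mulmxDl mulmxBl mul1mx [X in B (X *m _)]addrC addrA subrK.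
Qed.

Lemma inner_act_on_range G x y :
  inner (act_on_range G x) y = inner x (act_on_range (mxadj G) y).
Proof.
rewrite /act_on_range innerDl innerDr adj_cV inner_mulmx [inner x (B _)]innerC adj_cV.
rewrite -innerC; congr (_ + inner _ (_ *m _)).
by apply/matrixP => i j; rewrite !mxE rmorphB /= eq_sym rmorph_nat.
Qed.

Lemma sqn_act_on_range G x : (forall u : 'cV_d, sqn (G *m u) <= sqn u) ->
  sqn (act_on_range G x) <= sqn x.
Proof.
move=> sG; set c := adj B x.
have -> : act_on_range G x = (x - B c) + B (G *m c).
  by rewrite /act_on_range mulmxBl mul1mx linearB addrCA addrC.
have perp u : inner (x - B c) (B u) = 0 by exact: adj_iso_perp.
have {2}-> : x = (x - B c) + B c by rewrite subrK.
by rewrite (sqn_orth (perp _)) [leRHS](sqn_orth (perp c)) lerD2l !(isometric_sqn isoB).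
Qed.

Lemma sub_act_on_range G x : x - act_on_range G x = B ((1%:M - G) *m adj B x).
Proof. by rewrite /act_on_range opprD addrA subrr sub0r -linearN -mulNmx opprB. Qed.

End ActionOnRange.

(** * Characteristic function of the perturbed unitary operator *)

Section Perturbation.
Variables (R : realType) (X : innerType R) (d : nat).
Variables (B : {linear 'cV[R[i]]_d -> X}) (U W : {linear X -> X}).
Hypothesis isoB : isometric B.
Hypotheses (UK : cancel U W) (WK : cancel W U).
Hypothesis UW : forall x y, inner (U x) y = inner x (W y).
Variable Gam : 'M[R[i]]_d.
Hypothesis sGam : strictly_contractive (mulmx Gam : 'cV_d -> 'cV_d).

Let T := perturbation U B Gam.
Let J : {linear 'cV[R[i]]_d -> X} := W \o B.

Lemma perturbationE x : T x = act_on_range B Gam (U x).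
Proof. by []. Qed.

Lemma sqnU x : sqn (U x) = sqn x.
Proof. by rewrite /sqn UW UK. Qed.

Lemma sqnW x : sqn (W x) = sqn x.
Proof. by rewrite -sqnU WK. Qed.

Lemma isoJ : isometric J.
Proof. by move=> x; rewrite /inorm sqnW (isometric_sqn isoB). Qed.

Lemma adjJ : adj J = adj B \o U.
Proof. by apply: adjE => x y; rewrite innerC -UW -innerC adj_cV. Qed.

Lemma adj_perturbation : adj T = W \o act_on_range B (mxadj Gam).
Proof. by apply: adjE => x y; rewrite perturbationE inner_act_on_range UW. Qed.

Lemma contractive_perturbation : contractive T.
Proof.
split=> [a x y|x]; first by rewrite !perturbationE !linearP.
rewrite sqn_le_inorm -(sqnU x).
by apply: (sqn_act_on_range isoB) => u; exact: strictly_contractive_sqn.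
Qed.

Lemma sqn_adj_perturbation x : sqn (adj T x) <= sqn x.
Proof.
rewrite adj_perturbation /= sqnW; apply: (sqn_act_on_range isoB) => u.
exact/strictly_contractive_sqn/strictly_contractive_adj.
Qed.

Section Defects.
Variables D Ds : 'M[R[i]]_d.
Hypothesis pD : positive (mulmx D : 'cV_d -> 'cV_d).
Hypothesis pDs : positive (mulmx Ds : 'cV_d -> 'cV_d).
Hypothesis DD : D *m D = 1%:M - mxadj Gam *m Gam.
Hypothesis DsDs : Ds *m Ds = 1%:M - Gam *m mxadj Gam.

Lemma defect_perturbation : defect T = fun x => J (D *m adj J x).
Proof.
rewrite -(sqrtop_iso isoJ pD) /defect adj_perturbation; congr sqrtop.
apply/funext => x; rewrite /= perturbationE act_on_rangeM// adjJ /= mulmxA DD.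
by rewrite -sub_act_on_range linearB UK.
Qed.

Lemma defect_adj_perturbation : defect_adj T = fun x => B (Ds *m adj B x).
Proof.
rewrite -(sqrtop_iso isoB pDs) /defect_adj adj_perturbation; congr sqrtop.
apply/funext => x; rewrite perturbationE /= WK act_on_rangeM//.
by rewrite sub_act_on_range mulmxA DsDs.
Qed.

Hypotheses (uD : D \in unitmx) (uDs : Ds \in unitmx).

Lemma defect_space_perturbation : defect_space T = range J.
Proof.
rewrite /defect_space defect_perturbation.
by rewrite (range_iso_unit isoJ uD) (iclosure_range_iso isoJ).
Qed.

Lemma defect_adj_space_perturbation : defect_adj_space T = range B.
Proof.
rewrite /defect_adj_space defect_adj_perturbation.
by rewrite (range_iso_unit isoB uDs) (iclosure_range_iso isoB).
Qed.

Variables (z : R[i]) (Q : {linear X -> X}) (F : 'M[R[i]]_d).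
Hypothesis z1 : `|z| < 1.
Hypothesis QE : forall x, Q x - z *: W (Q x) = z *: W x.
Hypothesis FE : forall u : 'cV_d, F *m u = adj B (Q (B u)).
Let C := mxadj Gam - 1%:M.

Lemma adj_perturbationE x : adj T x = W (x + B (C *m adj B x)).
Proof. by rewrite adj_perturbation. Qed.

(** If [F C u = u], then [h = Q B C u] has [B^* h = u], and the equation of [Q]
    reads [h = z W (h + B C B^* h) = z T^* h]; contractivity of [T^*] forces
    [h = 0]. *)
Lemma one_sub_FC_unit : 1%:M - F *m C \in unitmx.
Proof.
apply: injective_unitmx => u; rewrite mulmxBl mul1mx -mulmxA FE.
set h := Q _ => /subr0_eq uE.
suff h0 : h = 0 by rewrite uE h0 linear0.
apply: (fixed_scaled_eq0 sqn_adj_perturbation z1).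
have hE : h - z *: W h = z *: W (B (C *m u)) := QE _.
by rewrite adj_perturbationE -uE linearD scalerDr -hE addrC subrK.
Qed.

(** Inverting [1 - z W] reduces [(1 - z T^* ) h = g] to
    [h = (1 + Q) g + Q B C x] with the unknown [x = B^* h], and applying [B^*]
    determines [x] by [(1 - FC) x = B^* (1 + Q) g]. Injectivity follows from
    contractivity of [T^*]. *)
Lemma bijective_one_sub_adj : bijective (fun x => x - z *: adj T x).
Proof.
pose x g := invmx (1%:M - F *m C) *m adj B (g + Q g).
pose h g := (g + Q g) + Q (B (C *m x g)).
have hK g : h g - z *: adj T (h g) = g.
  have Bh : adj B (h g) = x g.
    rewrite /h linearD /= -FE mulmxA; apply: (canLR (subrK _)).
    by rewrite -{1}[x g]mul1mx -mulmxBl /x mulKVmx// one_sub_FC_unit.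
  rewrite adj_perturbationE Bh.
  have hE : h g - z *: W (h g) = g + z *: W (B (C *m x g)).
    have h1 := QE g; have h2 := QE (B (C *m x g)).
    rewrite -h2 /h !linearD /= -opprD -h1 subrK addrACA.
    by rewrite addrK.
  by rewrite linearD scalerDr opprD addrA hE addrK.
have inj : injective (fun x => x - z *: adj T x).
  move=> u v uv; apply: subr0_eq; apply: (fixed_scaled_eq0 sqn_adj_perturbation z1).
  rewrite [adj T (u - v)](_ : _ = adj T u - adj T v); last first.
    by rewrite adj_perturbation /= !linearB.
  rewrite scalerBr; set a := z *: adj T u in uv *; set b := z *: adj T v in uv *.
  have -> : u = v - b + a by rewrite -uv subrK.
  by rewrite addrAC [v - b]addrC addrK addrC.
by exists h => // u; apply: inj; exact: hK.
Qed.

Lemma char_fun_perturbation u :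
  char_fun T (adj B \o U) (adj B) z u =
  - (Gam *m u) + Ds *m (invmx (1%:M - F *m C) *m F *m (D *m u)).
Proof.
rewrite /char_fun defect_space_perturbation -adjJ (adj_on_adj_iso isoJ).
have -> : defect T (J u) = J (D *m u).
  by rewrite defect_perturbation (adj_isoK isoJ).
set v := D *m u; set h := invop _ _.
have hE : h - z *: adj T h = J v := invopK bijective_one_sub_adj _.
rewrite linearD linearN perturbationE /= WK adj_act_on_range// adj_isoK//.
congr (_ + _); rewrite defect_adj_perturbation linZ /= adj_isoK// scalemxAr.
congr (_ *m _).
(* [1 - z W] is injective, and it takes the same value on both sides *)
have kE : z *: h = Q (B (C *m (z *: adj B h) + v)).
  set k := z *: h; set b := C *m _ + v.
  have hk : k - z *: W k = z *: W (B b).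
    have : h - z *: W h = z *: W (B (C *m adj B h)) + W (B v).
      apply/eqP; rewrite [eqbRHS]addrC -subr_eq -addrA -opprD -scalerDr -linearD.
      by rewrite -adj_perturbationE hE.
    move=> /(congr1 (fun x => z *: x)); rewrite /= scalerBr scalerDr => hh.
    have -> : W k = z *: W h by rewrite linZ.
    rewrite hh /b -scalemxAr linearD linearD scalerDr; congr (_ + _).
    by rewrite (linZ B) (linZ W).
  apply: subr0_eq; apply: (@fixed_scaled_eq0 _ _ W z) => // [x|]; first by rewrite sqnW.
  apply: subr0_eq; rewrite linearB scalerBr.
  by rewrite opprB [_ - z *: W k]addrC addrACA hk -QE addrACA subrr addNr addr0.
rewrite -mulmxA; apply: (canRL (mulKmx one_sub_FC_unit)).
rewrite mulmxBl mul1mx -mulmxA; apply/(canLR (subrK _)).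
transitivity (adj B (z *: h)); first by rewrite linZ.
by rewrite kE -FE mulmxDr opprK addrC.
Qed.

End Defects.
End Perturbation.

(** * Measurable complex functions on the circle *)

Section ComplexMeasurable.
Variable R : realType.
Implicit Types f g : circle R -> R[i].

Lemma cmeasN f : cmeasurable f -> cmeasurable (fun xi => - f xi).
Proof.
move=> [mr mi]; have ImN (w : R[i]) : complex.Im (- w) = - complex.Im w by case: w.
split.
  by under eq_fun do rewrite Defs.ReN; exact: measurable_funN.
by under eq_fun do rewrite ImN; exact: measurable_funN.
Qed.

Lemma cmeas_conj f : cmeasurable f -> cmeasurable (fun xi => Num.conj (f xi)).
Proof.
move=> [mr mi]; split; first by under eq_fun do rewrite Defs.Re_conj.
by under eq_fun do rewrite Defs.Im_conj; exact: measurable_funN.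
Qed.

(** [w^-1] is [conj w / |w|^2], also at [w = 0], and the real inverse is the power
    function with exponent [-1], which is measurable. *)
Lemma cmeasV f : cmeasurable f -> cmeasurable (fun xi => (f xi)^-1).
Proof.
move=> [mr mi].
have mV : measurable_fun setT (fun xi => (nsq (f xi))^-1).
  under eq_fun do rewrite -powR_inv1 ?addr_ge0 ?sqr_ge0//.
  apply: (measurableT_comp (measurable_powR _)).
  by apply: measurable_funD; exact: measurable_funX.
have VE w : w^-1 = (complex.Re w / nsq w) +i* - (complex.Im w / nsq w) :> R[i].
  by case: w.
split; under eq_fun do rewrite VE /=.
  exact: measurable_funM.
by apply: measurable_funN; exact: measurable_funM.
Qed.
End ComplexMeasurable.

(** * Multiplication operators on the direct integral *)

Section Multiplication.
Variables (R : realType) (E : sepHilbertType R).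
Variable mu : {finite_measure set (circle R) -> \bar R}.
Variable N : circle R -> option nat.
Implicit Types f g : dint E mu N.

Lemma dint_ae_eq f g : (\forall xi \ae mu, dfun_of f xi = dfun_of g xi) -> f = g.
Proof. by move=> fg; rewrite -[f]dfun_ofK -[g]dfun_ofK; exact/dclassP. Qed.

Lemma dscaleK a f : \forall xi \ae mu, dfun_of (a *: f) xi = a *: dfun_of f xi.
Proof. exact: dclassK. Qed.

(** Elements of the direct integral are classes, so an operator is described by
    its action on representatives almost everywhere; this determines it. *)
Definition multiplication_by (c : circle R -> R[i]) (M : dint E mu N -> dint E mu N) :=
  forall f, \forall xi \ae mu, dfun_of (M f) xi = c xi *: dfun_of f xi.

Lemma multiplication_exists (c : circle R -> R[i]) (K : R) :
  cmeasurable c -> (forall xi, nsq (c xi) <= K) ->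
  exists M : {linear dint E mu N -> dint E mu N}, multiplication_by c M.
Proof.
move=> mc cK.
have K0 : 0 <= K by apply: le_trans (cK point); rewrite addr_ge0 ?sqr_ge0.
have mulP (f : dfun E mu N) : (fun xi => c xi *: f xi : E) \in dint_pred mu N.
  have mf := dfun_wmeas f; have mcf := wmeasM mc mf.
  have [_ fi fN] : in_dint mu N f by case: (f) => g /= /dint_predP.
  apply/dint_predP; split => //.
    apply: (@sqn_integral_fin _ _ mu f f K 0) => // xi.
    by rewrite mul0r addr0 sqnZ ler_wpM2r ?sqn_ge0// -/(nsq _).
  apply: filterS fN => xi fx.
  by rewrite -[_ *: _]addr0; apply: clspan_lin => //; exact: clspan0.
pose M f : dint E mu N := dclass (Dfun (mulP (dfun_of f))).
have ME : multiplication_by c M by move=> f; exact: dclassK.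
have /linear_bundle[M' M'E] : linear M.
  move=> a f g; apply: dint_ae_eq.
  apply: filterS2 (filterI (ME (a *: f + g)) (dfun_of_lin a f g))
    (filterI (filterI (ME f) (ME g)) (dfun_of_lin a (M f) (M g))).
  move=> xi [-> ->] [[Mf Mg] ->].
  by rewrite Mf Mg scalerDr !scalerA mulrC.
by exists M'; rewrite M'E.
Qed.

Lemma inner_dintE f g :
  inner f g = Cintegral mu (fun xi => inner (dfun_of f xi) (dfun_of g xi)).
Proof. by []. Qed.

Lemma multiplication_adjoint c M M' : multiplication_by c M ->
  multiplication_by (fun xi => Num.conj (c xi)) M' ->
  forall f g, inner (M f) g = inner f (M' g).
Proof.
move=> cM cM' f g; rewrite !inner_dintE.
apply: Cintegral_ae; [exact: inner_cmeasurable..|].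
by apply: filterS2 (cM f) (cM' g) => xi -> ->; rewrite innerZl innerZr conjCK.
Qed.
End Multiplication.

(** * The kernel of the matrix-valued Cauchy integral *)

Section CauchyTransform.
Variables (R : realType) (E : sepHilbertType R).
Variable mu : {finite_measure set (circle R) -> \bar R}.
Variable N : circle R -> option nat.
Let U := @dmul R E mu N.

Lemma circle_conj_mul (xi : circle R) : Num.conj (val xi) * val xi = 1.
Proof. by rewrite mulrC -normCK (eqP (valP xi)) expr1n. Qed.

Lemma nsq_circle (xi : circle R) : nsq (val xi) = 1.
Proof. by apply: complexI; rewrite add_Re2_Im2 (eqP (valP xi)) expr1n. Qed.

Lemma dmul_unitary : exists U' W : {linear dint E mu N -> dint E mu N},
  [/\ U = U' :> (_ -> _), multiplication_by (fun xi => Num.conj (val xi)) W,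
    cancel U' W, cancel W U' & forall x y, inner (U' x) y = inner x (W y)].
Proof.
have [||U' mU] := @multiplication_exists R E mu N val 1; first exact: circle_measurable.
  by move=> xi; rewrite nsq_circle.
have [||W mW] := @multiplication_exists R E mu N (fun xi => Num.conj (val xi)) 1.
- exact/cmeas_conj/circle_measurable.
- by move=> xi; rewrite /nsq Defs.Re_conj Defs.Im_conj sqrrN -/(nsq _) nsq_circle.
exists U', W; split=> //.
- apply/funext => f; apply: dint_ae_eq.
  by apply: filterS2 (dmulE f) (mU f) => xi -> ->.
- move=> f; apply: dint_ae_eq; apply: filterS2 (mW (U' f)) (mU f) => xi -> ->.
  by rewrite scalerA circle_conj_mul scale1r.
- move=> f; apply: dint_ae_eq; apply: filterS2 (mU (W f)) (mW f) => xi -> ->.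
  by rewrite scalerA mulrC circle_conj_mul scale1r.
- exact: multiplication_adjoint.
Qed.

Variable z : R[i].
Hypothesis z1 : `|z| < 1.
Let q (xi : circle R) := z * Num.conj (val xi) / (1 - z * Num.conj (val xi)).

Lemma norm_z_conj (xi : circle R) : `|z * Num.conj (val xi)| = `|z|.
Proof. by rewrite normrM norm_conjC (eqP (valP xi)) mulr1. Qed.

Lemma kernel_denom_neq0 (xi : circle R) : 1 - z * Num.conj (val xi) != 0.
Proof.
apply/eqP => /subr0_eq e; have := z1; rewrite -(norm_z_conj xi) -e normr1.
by rewrite ltxx.
Qed.

Lemma kernel_measurable : cmeasurable q.
Proof.
have mw : cmeasurable (fun xi : circle R => z * Num.conj (val xi)).
  by apply: cmeasM; [exact: cmeas_cst|exact/cmeas_conj/circle_measurable].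
apply: cmeasM => //; apply: cmeasV; apply: cmeasD; first exact: cmeas_cst.
exact: cmeasN.
Qed.

(** On the circle [|1 - z conj(xi)| >= 1 - |z|]. *)
Lemma kernel_bounded xi : nsq (q xi) <= nsq (1 - `|z|)^-1.
Proof.
rewrite -lecR !add_Re2_Im2 ler_pXn2r ?nnegrE ?normr_ge0//.
have z1' : 0 < 1 - `|z| by rewrite subr_gt0.
rewrite normfV (gtr0_norm z1') /q normrM normfV norm_z_conj.
rewrite -[leRHS]mul1r; apply: ler_pM; rewrite ?normr_ge0 ?invr_ge0 ?normr_ge0//.
  exact: ltW.
rewrite lef_pV2 ?posrE ?normr_gt0 ?kernel_denom_neq0//.
by apply: le_trans (lerB_dist _ _); rewrite normr1 norm_z_conj.
Qed.

Lemma kernel_multiplication_exists : exists Q : {linear dint E mu N -> dint E mu N},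
  multiplication_by q Q.
Proof. exact: multiplication_exists kernel_measurable kernel_bounded. Qed.

Lemma kernel_resolvent (Q W : {linear dint E mu N -> dint E mu N}) :
  multiplication_by q Q -> multiplication_by (fun xi => Num.conj (val xi)) W ->
  forall f, Q f - z *: W (Q f) = z *: W f.
Proof.
move=> mQ mW f; apply/eqP; rewrite subr_eq addrC; apply/eqP/dint_ae_eq.
apply: filterS2 (filterI (mQ f) (mW f)) (filterI (filterI (mW (Q f)) (dscaleK z (W f)))
  (dfun_of_lin z (W (Q f)) (z *: W f))).
move=> xi [Qf Wf] [[WQf zWf] ->]; rewrite zWf WQf Wf Qf !scalerA -scalerDl.
congr (_ *: _); by rewrite /q; field; exact: kernel_denom_neq0.
Qed.

Variables (d : nat) (B : {linear 'cV[R[i]]_d -> dint E mu N}).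

(** Entry [(j, k)] of the matrix of [B^* Q B] is [(Q b_k, b_j)], which the inner
    product of the direct integral turns into the integral defining [F1]. *)
Lemma F1_mul (Q : {linear dint E mu N -> dint E mu N}) : multiplication_by q Q ->
  forall u : 'cV_d, F1 B z *m u = adj B (Q (B u)).
Proof.
move=> mQ u; rewrite [u in RHS]matrix_sum_delta !linear_sum.
apply/colP => j; rewrite mxE summxE; apply: eq_bigr => k _.
rewrite big_ord1 !linZ [RHS]mxE [LHS]mulrC /=; congr (_ * _).
rewrite [LHS]mxE -inner_delta_r innerC -adj_cV -innerC inner_dintE.
apply: Cintegral_ae.
- apply: cmeasM; first exact: kernel_measurable.
  by under eq_fun do rewrite mxE; exact: inner_cmeasurable.
- exact: inner_cmeasurable.
by apply: filterS (mQ (B (delta_mx k 0))) => xi ->; rewrite innerZl mxE.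
Qed.
End CauchyTransform.

Theorem theorem4p2 (R : realType) (E : sepHilbertType R)
    (mu : {finite_measure set (circle R) -> \bar R})
    (N : circle R -> option nat)
    (mN : forall k : option nat, measurable (N @^-1` [set k]))
    (d : nat) (B : {linear 'cV[R[i]]_d -> dint E mu N}) (isoB : isometric B)
    (Gam : 'M[R[i]]_d) (sGam : strictly_contractive (mulmx Gam : 'cV_d -> 'cV_d)) :
  let U := @dmul R E mu N in
  let T := perturbation U B Gam in
  let V := adj B \o U in
  let Vs := adj B in
  let G := mulmx Gam : 'cV_d -> 'cV_d in
  let Gams := map_mx Num.conj Gam^T in
  [/\ contractive T,
      unitary_on (defect_space T) V,
      unitary_on (defect_adj_space T) Vs &
      forall z : R[i], `|z| < 1 ->
      let F := F1 B z in
      [/\ 1%:M - (Gams - 1%:M) *m F \in unitmx,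
          1%:M - F *m (Gams - 1%:M) \in unitmx,
          forall x : 'cV_d, char_fun T V Vs z x =
            - G x + defect_adj G (F *m invmx (1%:M - (Gams - 1%:M) *m F)
                                    *m defect G x) &
          forall x : 'cV_d, char_fun T V Vs z x =
            - G x + defect_adj G (invmx (1%:M - F *m (Gams - 1%:M)) *m F
                                    *m defect G x)]].
Proof.
move=> U T V Vs G Gams.
have [U' [W [UE mW UK WK UW]]] := dmul_unitary E mu N.
have [D [pD DD uD DE]] := defect_matrix sGam.
have [Ds [pDs DsDs uDs DsE]] := defect_matrix (strictly_contractive_adj sGam).
rewrite mxadjK in DsDs; rewrite -defect_adj_mulmx in DsE.
rewrite /V /T /U UE; split.
- exact: contractive_perturbation isoB UK UW _ sGam.
- rewrite (defect_space_perturbation isoB UK WK UW pD DD uD).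
  rewrite -(adjJ B UW); exact: unitary_on_adj_iso (isoJ isoB UK WK UW).
- rewrite (defect_adj_space_perturbation isoB WK UW pDs DsDs uDs).
  exact: unitary_on_adj_iso isoB.
move=> z z1; have [Q mQ] := @kernel_multiplication_exists R E mu N z z1.
have QE := kernel_resolvent z1 mQ mW; have FE := F1_mul B mQ.
have ul := one_sub_FC_unit isoB UK WK UW sGam z1 QE FE.
have [ur pt] := push_through ul.
have cE := char_fun_perturbation isoB UK WK UW sGam pD pDs DD DsDs uD z1 QE FE.
split.
- exact: ur.
- exact: ul.
- by move=> x; rewrite cE /G DE DsE -pt.
- by move=> x; rewrite cE /G DE DsE.
Qed.
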